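(* Let $(A,\Vert\cdot\Vert)$ be a regular uniform normed Q-algebra with unit. If $\vert\cdot\vert$ is a uniform norm on $A$, then $\Vert x\Vert=\vert x\vert$ for all $x\in A$.
   Context: All algebras are associative algebras over the complex field $\mathbb{C}$, not assumed commutative or complete unless stated. A normed algebra is an algebra $A$ with a submultiplicative norm. A uniform seminorm on an algebra $A$ is a seminorm $p$ on $A$ satisfying $p(x^{2})=p(x)^{2}$ for all $x\in A$ (by a known theorem of Dedania such a seminorm is automatically submultiplicative); a uniform norm is a uniform seminorm which is a norm. A uniform normed algebra is a normed algebra $(A,\Vert\cdot\Vert)$ with $\Vert x^{2}\Vert=\Vert x\Vert^{2}$ for all $x\in A$. An element $x$ is quasi-invertible if there is $y\in A$ with $x+y-xy=x+y-yx=0$. A topological algebra is a Q-algebra if its set of quasi-invertible elements is open; a uniform normed Q-algebra is a uniform normed algebra that is a Q-algebra for its norm topology. For a topological algebra $A$, $M(A)$ denotes the set of all nonzero continuous multiplicative linear functionals $A\to\mathbb{C}$, endowed with the weak topology induced by the topological dual (the topology of pointwise convergence on $A$), and for $x\in A$ the Gelfand transform is $\widehat{x}:M(A)\to\mathbb{C}$, $\widehat{x}(g)=g(x)$. A topological algebra $A$ is regular if for every closed subset $F\subset M(A)$ and every $f_{1}\in M(A)$ with $f_{1}\notin F$ there exists $x\in A$ such that $\widehat{x}_{\vert F}=0$ and $\widehat{x}(f_{1})\neq 0$. Here regularity of $(A,\Vert\cdot\Vert)$ refers to the norm topology of $\Vert\cdot\Vert$. *)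

(* Defs.v *)
From HB Require Import structures.
From mathcomp Require Import all_boot all_order all_algebra.
From mathcomp Require Import all_classical all_reals all_analysis.
From mathcomp Require Import complex.

Set Implicit Arguments.
Unset Strict Implicit.
Unset Printing Implicit Defensive.

Import Order.TTheory GRing.Theory Num.Theory.
Import numFieldNormedType.Exports.

Local Open Scope classical_set_scope.
Local Open Scope ring_scope.

(* Everything is stated over a numFieldType K, to be instantiated with the
   complex field R[i]; norms are K-valued as in [normedModType K], and for
   K := R[i] the condition [0 <= z] says that z is a nonnegative real. *)

Record seminorm (K : numFieldType) (V : lmodType K) (p : V -> K) : Prop :=
  Seminorm {
    seminorm_ge0 : forall x, 0 <= p x;
    seminormD : forall x y, p (x + y) <= p x + p y;
    seminormZ : forall (a : K) x, p (a *: x) = `|a| * p x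
  }.

Record vnorm (K : numFieldType) (V : lmodType K) := Vnorm {
  vnorm_fun :> V -> K;
  vnorm_seminorm : seminorm vnorm_fun;
  vnorm_eq0 : forall x, vnorm_fun x = 0 -> x = 0
}.

(* [normed_by N] is V with the normed module structure, hence the topology,
   given by N. An alias is needed because several norms on the same algebra
   are considered, and because algType and normedModType have no join. *)
Definition normed_by (K : numFieldType) (V : lmodType K) (N : vnorm V) : Type :=
  V.

HB.instance Definition _ (K : numFieldType) (V : lmodType K) (N : vnorm V) :=
  GRing.Lmodule.on (normed_by N).

HB.instance Definition _ (K : numFieldType) (V : lmodType K) (N : vnorm V) :=
  Lmodule_isNormed.Build K (normed_by N)
    (seminormD (vnorm_seminorm N)) (seminormZ (vnorm_seminorm N))
    (@vnorm_eq0 K V N).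

Section Algebras.
Context {K : numFieldType} {A : algType K}.

(* Submultiplicativity is deliberately not required. *)
Definition uniform_seminorm (p : A -> K) : Prop :=
  seminorm p /\ forall x, p (x ^+ 2) = p x ^+ 2.

Definition uniform_norm (p : A -> K) : Prop :=
  uniform_seminorm p /\ forall x, p x = 0 -> x = 0.

Definition normed_algebra (N : vnorm A) : Prop :=
  forall x y, N (x * y) <= N x * N y.

Definition uniform_normed_algebra (N : vnorm A) : Prop :=
  normed_algebra N /\ forall x, N (x ^+ 2) = N x ^+ 2.

Definition quasi_invertible (x : A) : Prop :=
  exists y : A, x + y - x * y = 0 /\ x + y - y * x = 0.

Definition Q_algebra (N : vnorm A) : Prop :=
  open [set x : normed_by N | quasi_invertible x].

(* Used as a type (via the coercion [set_type]), [characters N] carries the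
   topology induced by [{ptws A -> K}]. *)
Definition characters (N : vnorm A) : set {ptws A -> K} :=
  [set g : A -> K | [/\ scalar g, {morph g : x y / x * y},
     continuous (g : normed_by N -> K) & exists x, g x <> 0]].

Definition gelfand_transform (N : vnorm A) (x : A) (g : characters N) : K :=
  (\val g : A -> K) x.

Definition regular_algebra (N : vnorm A) : Prop :=
  forall (F : set (characters N)) (f1 : characters N), closed F -> ~ F f1 ->
  exists x : A, (forall g, F g -> gelfand_transform x g = 0)
                /\ gelfand_transform x f1 <> 0.

End Algebras.

(* Main.v *)
Require Import Defs.
From mathcomp Require Import all_boot all_order all_algebra.
From mathcomp Require Import all_classical all_reals all_analysis.
From mathcomp Require Import complex.
From mathcomp Require Import ring lra.
Import Order.TTheory GRing.Theory Num.Theory.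
Import numFieldNormedType.Exports.
Local Open Scope ring_scope.

(** Everything rests on one fact about a commutative complex algebra [A] with a
    submultiplicative uniform seminorm [p]: for every [x] with [0 < p x] there
    is a character [g] with [|g| <= p] and [|g x| = p x]
    ([exists_norming_character]).

    Given this, let [F] be the set of characters bounded by [p]. It is closed
    in the pointwise topology. A character [f] outside [F] would be separated
    from [F] by some [y] with [f y <> 0] killed by all of [F]; but [y <> 0],
    so [0 < p y], and a character norming [y] for [p] lies in [F] and does not
    kill [y]. Hence every continuous character is bounded by [p], and a
    character norming [x] for [N] gives [N x <= p x]. Conversely a character
    norming [x] for [p] is bounded by [N], because in a uniform normed
    Q-algebra every character is ([Q_algebra_character_le]); so
    [p x <= N x]. The same automatic continuity is what makes the characters
    bounded by [p] elements of the space of [N]-continuous characters, on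
    which regularity can be used.

    The norming character is found without completing [A]. Among the uniform
    seminorms [q <= p] with [q 1 = 1] and [p x * q u <= q (x * u)], Zorn's lemma
    gives a minimal one. For [0 < q y] the seminorm
    [lim_n q (y ^ n * u) / q y ^ n] is again in this class and below [q], hence
    equal to [q], which forces [q (y * u) = q y * q u]
    ([exists_multiplicative_minorant]). A multiplicative seminorm on a complex
    algebra takes the value 0 at [y - c] for some scalar [c], by an elementary
    form of the Gelfand-Mazur theorem ([exists_scalar_dist0]), and [y |-> c] is
    the character.

    Two preliminaries make this applicable. The algebra is commutative
    ([unital_uniform_norm_comm]): uniformity gives [q (u * v) = q (v * u)], so
    [(1 + z a / n) ^ n * b * (1 - z a / n) ^ n], which approximates
    [exp (z a) b exp (- z a)], stays bounded for [|z| = r] as [n] grows, and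
    Cauchy's estimate for its coefficient [a b - b a] of [z] gives the bound
    [2 q b / r] for every [r]. A uniform norm on a commutative algebra is
    submultiplicative ([uniform_norm_submultiplicative]): polarization gives
    [p (x * y) <= 2 * (p x * p y)], and applying this to the powers
    [x ^ (2 ^ n)], [y ^ (2 ^ n)] removes the constant. *)

Local Notation normc := Normc.normc.

(** * Estimates in the real and complex fields *)

Lemma bernoulli_ge (R : realType) (s : R) n : 0 <= s -> 1 + n%:R * s <= (1 + s) ^+ n.
Proof.
move=> s0; elim: n => [|n IHn]; first by rewrite mul0r addr0 expr0.
rewrite exprS -natr1.
have n0 : 0 <= n%:R :> R by [].
apply: le_trans (ler_wpM2l _ IHn); last by lra.
have : 0 <= n%:R * s * s by rewrite !mulr_ge0.
lra.
Qed.

(** Used with [s] of order [1 / n ^ 2] to keep [(1 + s) ^ n] bounded, and with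
    [n * s] small to keep it close to 1. *)
Lemma bernoulli_le (R : realType) (s : R) n :
  0 <= s -> n%:R * s <= 2^-1 -> (1 + s) ^+ n <= 1 + 2 * (n%:R * s).
Proof.
move=> s0; elim: n => [|n IHn] ns; first by rewrite expr0 mul0r mulr0 addr0.
have n0 : 0 <= n%:R :> R by [].
move: ns; rewrite -natr1 exprS => ns.
have ns' : n%:R * s <= 2^-1 by lra.
apply: le_trans (ler_wpM2l _ (IHn ns')) _; first by lra.
have := ler_wpM2r s0 ns'.
lra.
Qed.

(** Taking roots: a constant factor disappears when an inequality holds for
    arbitrarily large powers. Exponents [2 ^ n] suffice, and are what the square
    property of a uniform seminorm provides. *)
Lemma le_of_exp_le (R : realType) (a b c : R) : 0 <= a -> 0 <= b ->
  (forall n, a ^+ (2 ^ n) <= c * b ^+ (2 ^ n)) -> a <= b.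
Proof.
move=> a0 b0 abc; rewrite leNgt; apply/negP => ltba.
have [b_eq0|b_neq0] := eqVneq b 0.
  have := abc 0%N; rewrite !expr1 b_eq0 mulr0 => a_le0.
  by move: (lt_le_trans ltba a_le0); rewrite b_eq0 ltxx.
have bgt0 : 0 < b by rewrite lt0r b_neq0.
pose s := a / b - 1.
have s0 : 0 < s by rewrite subr_gt0 ltr_pdivlMr// mul1r.
have as_ : a = b * (1 + s) by rewrite /s addrCA subrr addr0 mulrCA divff// mulr1.
have bound n : 1 + n%:R * s <= c.
  have := abc n; rewrite as_ exprMn mulrC ler_pM2r ?exprn_gt0//.
  apply: le_trans; apply: le_trans (bernoulli_ge _ _ _ (ltW s0)).
  by rewrite lerD2l ler_wpM2r ?(ltW s0)// ler_nat ltnW// ltn_expl.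
have := bound (Num.truncn (c / s)).+1.
have := truncnS_gt (c / s); rewrite ltr_pdivrMr// => h1 h2.
lra.
Qed.

Lemma exp2n_morph (S T : pzSemiRingType) (f : S -> T) :
  (forall x, f (x ^+ 2) = f x ^+ 2) -> forall k x, f (x ^+ (2 ^ k)) = f x ^+ (2 ^ k).
Proof. by move=> f2; elim=> [//|k IHk] x; rewrite expnS !exprM IHk f2. Qed.

Lemma normc_ge0 (R : realType) (z : R[i]) : 0 <= normc z.
Proof. by rewrite -lecR; exact: (normr_ge0 z). Qed.

Lemma normc_real (R : realType) (r : R) : 0 <= r -> normc (real_complex R r) = r.
Proof. by move=> r0; rewrite /= expr0n addr0 sqrtr_sqr ger0_norm. Qed.

Lemma normc_nat (R : realType) n : normc (n%:R : R[i]) = n%:R.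
Proof. by rewrite -(rmorph_nat (real_complex R)) normc_real. Qed.

Lemma le_normc_Re (R : realType) (z : R[i]) : complex.Re z <= normc z.
Proof.
by rewrite (le_trans (ler_norm _))// -lecR; exact: (normc_ge_Re z).
Qed.

Lemma normc_Re_Im (R : realType) (z : R[i]) : normc z <= `|complex.Re z| + `|complex.Im z|.
Proof.
case: z => a b /=; rewrite -[leRHS]ger0_norm ?addr_ge0// -sqrtr_sqr ler_wsqrtr//.
rewrite sqrrD !real_normK ?num_real// addrAC lerDl.
by rewrite mulrn_wge0// mulr_ge0.
Qed.

Lemma le_normc_Im (R : realType) (z : R[i]) : complex.Im z <= normc z.
Proof.
have := le_normc_Re _ (z * Complex 0 (-1)).
by rewrite Normc.normcM {2}/Normc.normc/= expr0n sqrrN expr1n add0r sqrtr1 mulr1;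
  case: z => a b /=; rewrite mulr0 mulrN1 opprK add0r.
Qed.

Lemma exists_between {R : realType} {T : Type} (t0 : T) (f g : T -> R) :
  (forall z w, f z <= g w) -> exists a, forall z, f z <= a /\ a <= g z.
Proof.
move=> fg; exists (inf (range g)) => z; split.
  apply: lb_le_inf; first by exists (g t0), t0.
  by move=> _ [w _ <-].
by apply: ge_inf; [exists (f t0) => _ [w _ <-]|exists z].
Qed.

(** * Unital uniform seminorms *)

Section UnitalUniformSeminorms.
Context {R : realType} {A : algType R[i]}.

(** Real-valued seminorms are used because infima are needed; nonnegativity
    follows from [uuD] and [uuZ]. *)
Record unital_uniform (q : A -> R) : Prop := UnitalUniform {
  uuD : forall x y, q (x + y) <= q x + q y;
  uuZ : forall (a : R[i]) x, q (a *: x) = normc a * q x;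
  uuM : forall x y, q (x * y) <= q x * q y;
  uu_sq : forall x, q (x ^+ 2) = q x ^+ 2;
  uu1 : q 1 = 1
}.

Context {q : A -> R}.
Hypothesis uq : unital_uniform q.

Lemma uu0 : q 0 = 0.
Proof. by rewrite -(scale0r 1) (uuZ _ uq) Normc.normc0 mul0r. Qed.

Lemma uuN x : q (- x) = q x.
Proof. by rewrite -scaleN1r (uuZ _ uq) normcN Normc.normc1 mul1r. Qed.

Lemma uu_ge0 x : 0 <= q x.
Proof.
by have := uuD _ uq x (- x); rewrite subrr uu0 uuN -mulr2n pmulrn_lge0.
Qed.

Lemma uu_scalar (a : R[i]) : q a%:A = normc a.
Proof. by rewrite (uuZ _ uq) (uu1 _ uq) mulr1. Qed.

Lemma uu_sum n (f : 'I_n -> A) : q (\sum_(i < n) f i) <= \sum_(i < n) q (f i).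
Proof.
apply: (big_ind2 (fun x s => q x <= s)) => //; first by rewrite uu0.
by move=> x s y t xs yt; apply: le_trans (uuD _ uq _ _) (lerD xs yt).
Qed.

Lemma uuX_le x n : q (x ^+ n) <= q x ^+ n.
Proof.
elim: n => [|n IHn]; first by rewrite !expr0 (uu1 _ uq).
by rewrite !exprS (le_trans (uuM _ uq _ _))// ler_wpM2l ?uu_ge0.
Qed.

(** The square property gives the exponents [2 ^ k]; an arbitrary [n] is
    completed to [2 ^ n] by submultiplicativity. *)
Lemma uuX x n : q (x ^+ n) = q x ^+ n.
Proof.
have X2 := exp2n_morph _ _ q (uu_sq _ uq).
apply/le_anti/andP; split; first exact: uuX_le.
have n_le : (n <= 2 ^ n)%N by rewrite ltnW// ltn_expl.
have [q0|q_neq0] := eqVneq (q x) 0.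
  case: n {n_le} => [|n]; first by rewrite !expr0 (uu1 _ uq).
  by rewrite q0 expr0n uu_ge0.
have qx : 0 < q x by rewrite lt0r q_neq0 uu_ge0.
rewrite -(ler_pM2r (exprn_gt0 (2 ^ n - n) qx)) -exprD subnKC// -X2.
rewrite -{1}(subnKC n_le) exprD (le_trans (uuM _ uq _ _))//.
by rewrite ler_wpM2l ?uu_ge0// uuX_le.
Qed.

(** [(x y) ^ (n + 1) = x (y x) ^ n y], so the two products have the same
    spectral radius, and a uniform seminorm is its own spectral radius. *)
Lemma uu_mul_swap x y : q (x * y) <= q (y * x).
Proof.
have shift n : (x * y) ^+ n.+1 = x * (y * x) ^+ n * y.
  elim: n => [|n IHn]; first by rewrite expr0 mulr1 expr1.
  by rewrite exprSr IHn (exprSr (y * x)) !mulrA.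
have [xy0|xy_neq0] := eqVneq (q (x * y)) 0; first by rewrite xy0 uu_ge0.
have xy_gt0 : 0 < q (x * y) by rewrite lt0r xy_neq0 uu_ge0.
apply: (@le_of_exp_le _ _ _ (q x * q y / q (x * y))); rewrite ?uu_ge0// => n.
rewrite mulrAC ler_pdivlMr// -exprSr -(uuX (x * y)) shift (le_trans (uuM _ uq _ _))//.
rewrite mulrAC ler_wpM2r ?uu_ge0// (le_trans (uuM _ uq _ _))//.
by rewrite ler_wpM2l ?uu_ge0// uuX_le.
Qed.

End UnitalUniformSeminorms.

(** * Commutativity *)

(** Iterated square roots of -1. *)
Lemma root_of_unity_2exp (R : realType) L :
  exists w : R[i], (2 ^ L.+1).-primitive_root w.
Proof.
have [w wN1] : exists w : R[i], w ^+ (2 ^ L) = -1.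
  elim: L => [|L [w IHw]]; first by exists (-1); rewrite expr1.
  by exists (sqrtc w); rewrite expnS exprM sqr_sqrtc.
have w1 : w ^+ (2 ^ L.+1) = 1 by rewrite expnSr exprM wN1 sqrrN expr1n.
have [m wm] := prim_order_exists (expn_gt0 2 L.+1) w1.
move=> /dvdn_pfactor -/(_ isT)[k kL mE]; exists w; rewrite {m}mE in wm.
move: kL; rewrite leq_eqVlt => /orP[/eqP <- //|]; rewrite ltnS => kL.
have := prim_expr_order wm; move: wN1.
rewrite -(subnKC kL) expnD exprM => + wk1; rewrite wk1 expr1n => /eqP.
by rewrite -subr_eq0 opprK -(natrD _ 1 1) pnatr_eq0.
Qed.

Lemma sum_prim_root_powers (F : fieldType) (w : F) M k :
  M.-primitive_root w ->
  \sum_(j < M) (w ^+ k) ^+ j = if (M %| k)%N then M%:R else 0.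
Proof.
move=> prim_w; rewrite (prim_order_dvd prim_w); case: eqP => [->|/eqP wk].
  by under eq_bigr do rewrite expr1n; rewrite sumr_const card_ord.
apply: (@mulfI _ (w ^+ k - 1)); first by rewrite subr_eq0.
by rewrite -subrX1 -exprM mulnC exprM (prim_expr_order prim_w) expr1n subrr mulr0.
Qed.

Section Commutativity.
Context {R : realType} {A : algType R[i]}.
Context {q : A -> R}.
Hypothesis uq : unital_uniform q.

Lemma horner_scalar (F : {poly A}) n (z : R[i]) : (size F <= n)%N ->
  F.[z%:A] = \sum_(i < n) z ^+ i *: F`_i.
Proof.
move=> Fn; rewrite (horner_coef_wide _ Fn); apply: eq_bigr => i _.
by rewrite exprZn expr1n -scalerAr mulr1.
Qed.

(** Cauchy's estimate, with the contour integral replaced by an average over the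
    [M]-th roots of unity for [M] larger than the degree: it isolates the
    coefficient exactly. *)
Lemma cauchy_coef1 (F : {poly A}) (r c : R) : 0 < r ->
  (forall z : R[i], normc z = r -> q F.[z%:A] <= c) -> r * q F`_1 <= c.
Proof.
move=> r0 Fc; pose M := (2 ^ (size F).+1)%N.
have [w prim_w] := root_of_unity_2exp R (size F); rewrite -/M in prim_w.
have M1 : (1 < M)%N by rewrite -(expn0 2) ltn_exp2l.
have FM : (size F <= M)%N by rewrite ltnW// ltnW// ltn_expl.
have Mgt0 : 0 < M%:R :> R by rewrite ltr0n ltnW.
have nw k : normc (w ^+ k) = 1.
  apply: complexI; rewrite -[LHS]/(`|w ^+ k|) normrX.
  suff /eqP -> : `|w| == 1 by rewrite expr1n.
  by rewrite -(@pexpr_eq1 _ _ M) ?(ltnW M1)// -normrX (prim_expr_order prim_w) normr1.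
(* The factor w ^ (j * M.-1) is w ^ (- j), so that the weight of the
   coefficient i is the power sum of exponent i - 1. *)
have filterE : \sum_(j < M) w ^+ (j * M.-1) *: F.[(real_complex R r * w ^+ j)%:A]
               = (M%:R * real_complex R r) *: F`_1.
  under eq_bigr => j _ do rewrite (horner_scalar _ _ _ FM) scaler_sumr.
  rewrite exchange_big /=.
  transitivity (\sum_(i < M)
     (real_complex R r ^+ i * (if (M %| i + M.-1)%N then M%:R else 0)) *: F`_i).
    apply: eq_bigr => i _.
    rewrite -(sum_prim_root_powers _ _ _ _ prim_w) mulr_sumr scaler_suml.
    apply: eq_bigr => j _; rewrite scalerA; congr (_ *: _).
    by rewrite exprMn -!exprM mulnDl exprD (mulnC M.-1) (mulnC i); ring.
  rewrite (bigD1 (Ordinal M1)) //= [X in _ + X]big1 ?addr0.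
    by rewrite add1n prednK ?(ltnW M1)// dvdnn expr1 mulrC.
  move=> i i1; rewrite ifN ?mulr0 ?scale0r//.
  case: i i1 => [[|[|i]] iM] //= _.
    by rewrite add0n gtnNdvd// ?prednK// ?ltn_predL ?(ltnW M1)// -subn1 subn_gt0.
  rewrite addSn -addnS prednK ?(ltnW M1)// dvdn_addl// gtnNdvd//.
  exact: ltnW.
have : q (\sum_(j < M) w ^+ (j * M.-1) *: F.[(real_complex R r * w ^+ j)%:A]) <= M%:R * c.
  apply: le_trans (uu_sum uq _ _) _; rewrite -[M in M%:R]card_ord -sum1_card natr_sum mulr_suml.
  apply: ler_sum => j _; rewrite (uuZ _ uq) nw mul1r mul1r Fc//.
  by rewrite Normc.normcM nw mulr1 normc_real ?(ltW r0).
rewrite filterE (uuZ _ uq) Normc.normcM normc_nat normc_real ?(ltW r0)//.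
by rewrite -mulrA ler_pM2l.
Qed.

Lemma coef01_exp1DX (c : A) n :
  ((1 + c *: 'X) ^+ n)`_0 = 1 /\ ((1 + c *: 'X) ^+ n)`_1 = c *+ n.
Proof.
elim: n => [|n [IH0 IH1]]; first by rewrite expr0 !coef1.
rewrite exprS !coefM !big_ord_recl !big_ord0 /= !coefD !coefZ !coefX !coef1 /=.
by rewrite /bump /= IH0 IH1 !mulr0 !mulr1 !addr0 add0r !mul1r; split => //; rewrite -mulrSr.
Qed.

Lemma horner_exp1DX (c : A) n (z : R[i]) :
  ((1 + c *: 'X) ^+ n).[z%:A] = (1 + z *: c) ^+ n.
Proof.
have comm_z (p : {poly A}) : comm_poly p z%:A.
  by rewrite /comm_poly -scalerAr mulr1 -scalerAl mul1r.
elim: n => [|n IHn]; first by rewrite !expr0 hornerE.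
rewrite !exprS hornerM_comm// IHn; congr (_ * _).
by rewrite hornerD hornerZ hornerX hornerC -scalerAr mulr1.
Qed.

(** The polynomial [F] below has coefficients [b] and [a b - b a] in degrees 0
    and 1. Swapping the factors bounds [q F] on the circle of radius [r] by
    [q b * (1 + (r q(a) / n) ^ 2) ^ n], which is at most [2 q b] once [n] is large:
    Liouville's argument, with [(1 + z a / n) ^ n] in place of [exp (z a)] so that
    no completeness is involved. *)
Lemma unital_uniform_norm_comm : (forall x, q x = 0 -> x = 0) ->
  forall a b : A, a * b = b * a.
Proof.
move=> q_eq0 a b; apply/eqP; rewrite -subr_eq0; apply/eqP; apply: q_eq0.
have key r : 0 < r -> r * q (a * b - b * a) <= 2 * q b.
  move=> r0; pose t := r * q a.
  have t0 : 0 <= t by rewrite mulr_ge0 ?(ltW r0) ?uu_ge0.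
  pose n := (Num.truncn (2 * t ^+ 2)).+1.
  have nt : 2 * t ^+ 2 < n%:R by exact: truncnS_gt.
  have n0 : 0 < n%:R :> R by rewrite ltr0n.
  pose c : A := n%:R^-1 *: a.
  pose F : {poly A} := (1 + c *: 'X) ^+ n * b%:P * (1 + (- c) *: 'X) ^+ n.
  have cn : c *+ n = a.
    by rewrite -scaler_nat scalerA divff ?scale1r// pnatr_eq0.
  have F1 : F`_1 = a * b - b * a.
    have [P0 P1] := coef01_exp1DX c n; have [Q0 Q1] := coef01_exp1DX (- c) n.
    rewrite /F !coefM !big_ord_recl !big_ord0 /bump /= !coefMC P0 P1 Q0 Q1.
    by rewrite mulNrn cn mul1r mulr1 mulrN addr0 addrC.
  rewrite -F1; apply: cauchy_coef1 => // z zr.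
  have comm_z (p : {poly A}) : comm_poly p z%:A.
    by rewrite /comm_poly -scalerAr mulr1 -scalerAl mul1r.
  rewrite /F !hornerM_comm// hornerC !horner_exp1DX -mulrA.
  apply: le_trans (uu_mul_swap uq _ _) _; rewrite -mulrA.
  apply: le_trans (uuM _ uq _ _) _; rewrite mulrC ler_wpM2r ?uu_ge0//.
  have -> : (1 + z *: - c) ^+ n * (1 + z *: c) ^+ n = (1 - (z *: c) ^+ 2) ^+ n.
    have prodBD (w : A) : (1 - w) * (1 + w) = 1 - w ^+ 2.
      by rewrite mulrDl mul1r mulrDr mulr1 mulNr addrA addrK expr2.
    rewrite scalerN -exprMn_comm ?prodBD// /GRing.comm prodBD.
    by have := prodBD (- (z *: c)); rewrite opprK sqrrN => ->.
  apply: le_trans (uuX_le uq _ _) _.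
  pose s := (t / n%:R) ^+ 2.
  have s0 : 0 <= s by rewrite sqr_ge0.
  have qs : q (1 - (z *: c) ^+ 2) <= 1 + s.
    apply: le_trans (uuD _ uq _ _) _; rewrite (uu1 _ uq) (uuN uq) lerD2l (uu_sq _ uq).
    rewrite !(uuZ _ uq) zr Normc.normcV.
    by rewrite normc_nat mulrA mulrAC.
  apply: le_trans (@lerXn2r _ n _ _ _ _ qs) _; rewrite ?nnegrE ?uu_ge0 ?addr_ge0//.
  have ns : n%:R * s <= 2^-1.
    have -> : n%:R * s = t ^+ 2 / n%:R.
      by rewrite /s; field; rewrite lt0r_neq0.
    by rewrite ler_pdivrMr//; lra.
  apply: le_trans (bernoulli_le _ _ _ s0 ns) _; lra.
apply/eqP; rewrite eq_le uu_ge0// andbT leNgt; apply/negP => d0.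
have qb := uu_ge0 uq b.
have r0 : 0 < (2 * q b + 1) / q (a * b - b * a) by rewrite divr_gt0//; lra.
by have := key _ r0; rewrite divfK ?lt0r_neq0//; lra.
Qed.
End Commutativity.

(** * Directed infima and localization *)

Section DirectedInfimum.
Context {R : realType} {A : algType R[i]} {I : Type}.
Variables (i0 : I) (f : I -> A -> R).
Hypothesis f0 : forall i x, 0 <= f i x.
Local Notation q := (fun x => inf (range (fun i => f i x))).

Lemma family_inf_le i x : q x <= f i x.
Proof.
by apply: ge_inf; [exists 0 => _ [j _ <-]|exists i].
Qed.

Lemma le_family_inf c x : (forall i, c <= f i x) -> c <= q x.
Proof.
by move=> cf; apply: lb_le_inf; [exists (f i0 x), i0|move=> _ [i _ <-]].
Qed.

Lemma le_family_inf_mul c d x : 0 <= d ->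
  (forall i, c <= f i x * d) -> c <= q x * d.
Proof.
rewrite le_eqVlt => /orP[/eqP <-|d0] cf; first by have := cf i0; rewrite !mulr0.
by rewrite -ler_pdivrMr//; apply: le_family_inf => i; rewrite ler_pdivrMr.
Qed.

(** Covers two kinds of directed families: chains of uniform seminorms, and the
    seminorms defining a localization, whose members are not submultiplicative
    themselves. Hence the hypotheses relate distinct members. *)
Lemma unital_uniform_family_inf :
  (forall i a x, f i (a *: x) = normc a * f i x) ->
  (forall i j, exists k, forall x y, f k (x + y) <= f i x + f j y) ->
  (forall i j, exists k, forall x y, f k (x * y) <= f i x * f j y) ->
  (forall i, exists j, forall x, f j x ^+ 2 <= f i (x ^+ 2)) ->
  (forall i, f i 1 = 1) ->
  unital_uniform (q : A -> R).
Proof.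
move=> fZ fD fM fsq f1.
have q0 x : 0 <= q x by exact: le_family_inf.
have qM x y : q (x * y) <= q x * q y.
  apply: le_family_inf_mul => // i; rewrite mulrC.
  apply: le_family_inf_mul => // j; rewrite mulrC.
  by have [k fk] := fM i j; rewrite (le_trans (family_inf_le k _)).
split => //.
- move=> x y; rewrite -lerBlDr; apply: le_family_inf => i; rewrite lerBlDr -lerBlDl.
  apply: le_family_inf => j; rewrite lerBlDl.
  by have [k fk] := fD i j; rewrite (le_trans (family_inf_le k _)).
- move=> a x; apply/le_anti/andP; split.
    rewrite mulrC; apply: le_family_inf_mul; first exact: normc_ge0.
    by move=> i; rewrite mulrC -fZ family_inf_le.
  by apply: le_family_inf => i; rewrite fZ ler_wpM2l ?normc_ge0// family_inf_le.
- move=> x; apply/le_anti/andP; split; first by rewrite !expr2.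
  apply: le_family_inf => i; have [j fj] := fsq i.
  by rewrite (le_trans _ (fj x))// lerXn2r ?nnegrE// family_inf_le.
- apply/le_anti/andP; split; first by rewrite -(f1 i0) family_inf_le.
  by apply: le_family_inf => i; rewrite f1.
Qed.
End DirectedInfimum.

Section Localization.
Context {R : realType} {A : algType R[i]} {q : A -> R}.
Hypothesis uq : unital_uniform q.
Hypothesis mulA_comm : forall x y : A, x * y = y * x.
Variable y : A.
Hypothesis qy : 0 < q y.

Let f n x := q (y ^+ n * x) / q y ^+ n.
(** The infimum is a limit, as the sequence is nonincreasing. It is the seminorm
    that [q] induces on the algebra with [y] inverted, normalized so that [y]
    acts by multiplication of the seminorm by [q y]. *)
Definition localization x := inf (range (fun n => f n x)).

Let f0 n x : 0 <= f n x.
Proof. by rewrite divr_ge0 ?exprn_ge0 ?(uu_ge0 uq). Qed.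

Let f_anti m n x : f (m + n) x <= f m x.
Proof.
rewrite /f ler_pdivrMr ?exprn_gt0// [in leRHS]exprD mulrA divfK ?lt0r_neq0 ?exprn_gt0//.
rewrite [leRHS]mulrC addnC exprD -mulrA.
by rewrite (le_trans (uuM _ uq _ _))// (uuX uq).
Qed.

Lemma localization_le x : localization x <= q (y * x) / q y.
Proof. by have := family_inf_le f f0 1%N x; rewrite /f !expr1. Qed.

Lemma localization_le_self x : localization x <= q x.
Proof. by have := family_inf_le f f0 0%N x; rewrite /f !expr0 mul1r divr1. Qed.

Lemma localization_unital_uniform : unital_uniform localization.
Proof.
apply: (unital_uniform_family_inf 0%N f f0).
- by move=> n a x; rewrite /f -scalerAr (uuZ _ uq) mulrA.
- move=> i j; exists (i + j)%N => u v.
  apply: (@le_trans _ _ (f (i + j) u + f (i + j) v)).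
    by rewrite /f -mulrDl ler_wpM2r ?invr_ge0 ?exprn_ge0 ?(ltW qy)// mulrDr (uuD _ uq).
  by rewrite lerD ?f_anti// addnC f_anti.
- move=> i j; exists (i + j)%N => u v.
  rewrite /f mulrACA -invfM -exprD ler_wpM2r ?invr_ge0 ?exprn_ge0 ?(ltW qy)//.
  have -> : y ^+ (i + j) * (u * v) = (y ^+ i * u) * (y ^+ j * v).
    by rewrite exprD -!mulrA; congr (_ * _); rewrite mulA_comm -mulrA (mulA_comm v).
  exact: (uuM _ uq).
- move=> i; exists i => x; apply: le_trans (f_anti i i _).
  rewrite /f expr_div_n -exprM muln2 -addnn ler_wpM2r ?invr_ge0 ?exprn_ge0 ?(ltW qy)//.
  rewrite -(uu_sq _ uq) exprMn_comm; last exact: mulA_comm.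
  by rewrite -exprM muln2 -addnn.
- by move=> n; rewrite /f mulr1 (uuX uq) divff// lt0r_neq0// exprn_gt0.
Qed.

(** Localizing at [y] does not destroy a lower bound for the multiplication by
    another element: this keeps control of [x] in the minimality argument. *)
Lemma localization_expansive c u : 0 <= c -> (forall x, c * q x <= q (u * x)) ->
  forall x, c * localization x <= localization (u * x).
Proof.
move=> c0 cu x; apply: (le_family_inf 0%N) => n.
apply: (@le_trans _ _ (c * f n x)).
  by rewrite ler_wpM2l// (family_inf_le f f0).
rewrite /f (mulrA c) ler_wpM2r ?invr_ge0 ?exprn_ge0 ?(ltW qy)//.
by rewrite mulrA (mulA_comm _ u) -mulrA.
Qed.

Lemma localization_expansive_self x : q y * localization x <= localization (y * x).
Proof.
apply: (le_family_inf 0%N) => n.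
apply: (@le_trans _ _ (q y * f n.+1 x)).
  by rewrite ler_wpM2l ?(ltW qy)// (family_inf_le f f0).
by rewrite /f (exprS (q y)) exprSr invfM -mulrA (mulrCA (q y)) (mulrA (q y))
  divff ?lt0r_neq0// mul1r.
Qed.
End Localization.

(** * Multiplicative minorants *)

(** The condition [p x * q u <= q (x * u)] passes to infima of chains and to
    localizations, unlike the equality [q x = p x], which it implies at
    [u = 1]; the localization of [p] at [x] satisfies it. *)
Lemma exists_multiplicative_minorant (R : realType) (A : algType R[i]) (p : A -> R) (x : A) :
  (forall u v : A, u * v = v * u) -> unital_uniform p -> 0 < p x ->
  exists q : A -> R, [/\ unital_uniform q, (forall u v, q (u * v) = q u * q v),
    (forall u, q u <= p u) & p x <= q x].
Proof.
move=> comm up px.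
pose P (q : A -> R) := [/\ unital_uniform q, (forall u, q u <= p u) &
  forall u, p x * q u <= q (x * u)].
pose T := {q : A -> R | P q}.
pose Rel (s t : T) := `[< forall u, sval t u <= sval s u >].
have P0 : P (localization (q := p) x).
  split; [exact: localization_unital_uniform|exact: localization_le_self|
          exact: localization_expansive_self].
have [||C Ctot|[q [uq qp qx]] qmin] := @ZL_preorder T (exist _ _ P0) Rel.
- by move=> t; apply/asboolP.
- by move=> r s t /asboolP rs /asboolP st; apply/asboolP => u; exact: le_trans (st u) (rs u).
- have [[t0 Ct0]|C0] := pselect (exists t, C t); last first.
    by exists (exist _ _ P0) => s Cs; case: C0; exists s.
  pose I := {t | C t}; pose f (i : I) := sval (sval i).
  pose i0 : I := exist _ t0 Ct0.
  have Pf i : P (f i) by rewrite /f; exact: svalP.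
  have f0 i u : 0 <= f i u by have [uf _ _] := Pf i; exact: uu_ge0.
  have dir i j : exists k, forall u, f k u <= f i u /\ f k u <= f j u.
    have [ij|ji] := Ctot _ _ (svalP i) (svalP j).
      by exists j => u; split => //; exact: (asboolW ij).
    by exists i => u; split => //; exact: (asboolW ji).
  have Pinf : P (fun u => inf (range (fun i => f i u))).
    split.
    + apply: (unital_uniform_family_inf i0 f f0).
      * by move=> i a u; have [uf _ _] := Pf i; exact: uuZ.
      * move=> i j; have [k fk] := dir i j; exists k => u v.
        have [uf _ _] := Pf k; apply: le_trans (uuD _ uf _ _) _.
        by rewrite lerD ?(fk u).1 ?(fk v).2.
      * move=> i j; have [k fk] := dir i j; exists k => u v.
        have [uf _ _] := Pf k; apply: le_trans (uuM _ uf _ _) _.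
        by rewrite ler_pM ?f0 ?(fk u).1 ?(fk v).2.
      * by move=> i; exists i => u; have [uf _ _] := Pf i; rewrite (uu_sq _ uf).
      * by move=> i; have [uf _ _] := Pf i; exact: uu1.
    + by move=> u; rewrite (le_trans (family_inf_le f f0 i0 u))//; have [] := Pf i0.
    + move=> u; apply: (le_family_inf i0) => i.
      have [_ _ fx] := Pf i; apply: le_trans (fx u).
      by rewrite ler_wpM2l ?(ltW px)// (family_inf_le f f0).
  exists (exist _ _ Pinf) => s Cs; apply/asboolP => u.
  exact: (family_inf_le f f0 (exist _ s Cs) u).
exists q; split => //; last first.
  by have := qx 1; rewrite mulr1 (uu1 _ uq) mulr1.
move=> u v; apply/le_anti/andP; split; first exact: (uuM _ uq).
have [qu0|qu_neq0] := eqVneq (q u) 0; first by rewrite qu0 mul0r uu_ge0.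
have qu : 0 < q u by rewrite lt0r qu_neq0 uu_ge0.
have Pu : P (localization (q := q) u).
  split; first exact: localization_unital_uniform.
    by move=> w; rewrite (le_trans (localization_le_self uq _ _)).
  exact: localization_expansive (ltW px) _.
(* By minimality, q is equal to its localization at u. *)
have qle : forall w, q w <= localization (q := q) u w.
  apply/asboolP; apply: (qmin (exist _ _ Pu)).
  by apply/asboolP => w; exact: localization_le_self.
rewrite mulrC -ler_pdivlMr//; apply: le_trans (qle v) _.
exact: localization_le.
Qed.

(** * Gelfand-Mazur for multiplicative seminorms *)

Section MultiplicativeSeminorm.
Context {R : realType} {A : algType R[i]} {q : A -> R}.
Hypothesis uq : unital_uniform q.
Hypothesis qM : forall x y, q (x * y) = q x * q y.

Lemma sqr_sub_scalar (y : A) (s : R[i]) :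
  y ^+ 2 - (s ^+ 2)%:A = (y - s%:A) * (y - (- s)%:A).
Proof.
rewrite scaleNr opprK mulrDl !mulrDr mulNr mulNr -!scalerAl -!scalerAr !mul1r mulr1.
by rewrite addrA addrK -expr2 scalerA expr2.
Qed.

(** Since complex numbers have square roots, [y ^ (2 ^ k) - c] is a product of
    [2 ^ k] factors [y - c']. *)
Lemma dist_pow2_ge m y : 0 <= m -> (forall c, m <= q (y - c%:A)) ->
  forall k c, m ^+ (2 ^ k) <= q (y ^+ (2 ^ k) - c%:A).
Proof.
move=> m0 ym; elim=> [|k IHk] c; first by rewrite !expr1.
rewrite expnSr !exprM -(sqr_sqrtc c) sqr_sub_scalar qM expr2.
by rewrite ler_pM ?exprn_ge0.
Qed.

(** [y - w] is one of the [2 ^ k] linear factors of [y ^ (2 ^ k) - w ^ (2 ^ k)],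
    and the other ones are bounded below by [m]. *)
Lemma dist_mul_pow2_le m y : 0 <= m -> (forall c, m <= q (y - c%:A)) ->
  forall k w, q (y - w%:A) * m ^+ (2 ^ k) <= m * (q y ^+ (2 ^ k) + normc w ^+ (2 ^ k)).
Proof.
move=> m0 ym k w.
have normcX n : normc (w ^+ n) = normc w ^+ n.
  elim: n => [|n IHn]; first by rewrite !expr0 Normc.normc1.
  by rewrite !exprS Normc.normcM IHn.
apply: (@le_trans _ _ (m * q (y ^+ (2 ^ k) - (w ^+ (2 ^ k))%:A))); last first.
  rewrite ler_wpM2l//; apply: le_trans (uuD _ uq _ _) _.
  by rewrite (uuN uq) (uu_scalar uq) normcX (uuX uq).
elim: k => [|k IHk]; first by rewrite !expr1 mulrC.
rewrite expnSr !exprM sqr_sub_scalar qM expr2 !mulrA ler_pM ?mulr_ge0 ?exprn_ge0 ?(uu_ge0 uq)//.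
exact: dist_pow2_ge.
Qed.

(** Ostrowski's argument. If the infimum [m] of the distances from [y] to the
    scalars were positive, [dist_mul_pow2_le] would show that a scalar at
    distance close to [m] remains so after the translation by [m / 2]: the bound
    is [m * ((1 + s) ^ n + 2 ^ (- n))]. Repeating it gives scalars of arbitrarily
    large modulus at distance less than [2 * m], which is absurd. *)
Lemma dist_scalars_inf0 (y : A) e : 0 < e -> exists c : R[i], q (y - c%:A) < e.
Proof.
move=> e0; apply: contrapT => /forallNP no.
pose D := range (fun c : R[i] => q (y - c%:A)).
have D0 : (D !=set0)%classic by exists (q (y - 0%:A)), 0.
pose m := inf D.
have ym c : m <= q (y - c%:A).
  apply: ge_inf; last by exists c.
  by exists 0 => _ [z _ <-]; exact: uu_ge0.
have m0 : 0 < m.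
  apply: lt_le_trans e0 _; apply: lb_le_inf => // _ [c _ <-].
  by rewrite leNgt; apply/negP/no.
have near_m d : 0 < d -> exists c, q (y - c%:A) <= m * (1 + d).
  move=> d0; have md : 0 < m * d by rewrite mulr_gt0.
  have [|_ [c _ <-] cm] := inf_adherent md (E := D).
    by split=> //; exists 0 => _ [z _ <-]; exact: uu_ge0.
  by exists c; rewrite mulrDr mulr1 ltW.
pose B := q y + m * 2.
have bounded d c : d <= 1 -> q (y - c%:A) <= m * (1 + d) -> normc c <= B.
  move=> d1 cm; rewrite -(uu_scalar uq) -[c%:A](subKr y).
  apply: le_trans (uuD _ uq _ _) _; rewrite (uuN uq) lerD2l (le_trans cm)//.
  by rewrite ler_pM2l//; lra.
have walk k : forall d, 0 < d -> d <= 1 -> exists c : R[i],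
    q (y - c%:A) <= m * (1 + d) /\ k%:R * (m / 2) - B <= complex.Re c.
  elim: k => [|k IHk] d d0 d1.
    have [c cm] := near_m d d0; exists c; split => //.
    have := le_normc_Re _ (- c); rewrite normcN => cB.
    have := bounded _ _ d1 cm; case: c cm cB => a b /= cm cB; lra.
  (* n makes 2 ^ (- n) at most d / 2, then s makes (1 + s) ^ n at most 1 + d / 2. *)
  pose l := (Num.truncn (2 / d)).+1; pose n := (2 ^ l)%N.
  have n0 : 0 < n%:R :> R by rewrite ltr0n expn_gt0.
  have half_n : 2^-1 ^+ n <= d / 2.
    rewrite -[d / 2]invf_div exprVn lef_pV2 ?posrE ?divr_gt0 ?exprn_gt0//.
    rewrite ltW// (lt_trans (truncnS_gt _))// -natrX ltr_nat.
    by rewrite (ltn_trans (ltn_expl l (ltnSn 1)))// ltn_expl.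
  pose s := d / (4 * n%:R).
  have s0 : 0 < s by rewrite divr_gt0// mulr_gt0.
  have ns : n%:R * s = d / 4 by rewrite /s; field; rewrite lt0r_neq0.
  have s1 : s <= 1.
    have : 1 <= n%:R :> R by rewrite ler1n expn_gt0.
    by rewrite /s ler_pdivrMr ?mulr_gt0//; lra.
  have [c [cm cB]] := IHk s s0 s1.
  exists (c + real_complex R (m / 2)); split; last first.
    by case: c {cm} cB => a b /=; rewrite -natr1; lra.
  have ym' c' : m <= q (y - c%:A - c'%:A) by rewrite -addrA -opprD -scalerDl.
  have := dist_mul_pow2_le m (y - c%:A) (ltW m0) ym' l (real_complex R (m / 2)).
  rewrite -addrA -opprD -scalerDl -/n normc_real; last by rewrite divr_ge0// ltW.
  have qn : q (y - c%:A) ^+ n <= m ^+ n * (1 + d / 2).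
    apply: (@le_trans _ _ ((m * (1 + s)) ^+ n)).
      by rewrite lerXn2r ?nnegrE ?uu_ge0// mulr_ge0//; lra.
    rewrite exprMn ler_wpM2l ?exprn_ge0 ?(ltW m0)//.
    apply: le_trans (bernoulli_le _ _ n (ltW s0) _) _; lra.
  move=> h; rewrite -(ler_pM2r (exprn_gt0 n m0)) (le_trans h)//.
  rewrite -mulrA ler_pM2l// exprMn.
  have mn := exprn_gt0 n m0.
  have := ler_wpM2l (ltW mn) half_n.
  lra.
pose k := (Num.truncn (2 * B / (m / 2))).+1.
have [c [cm cB]] := walk k 1 ltr01 (lexx _).
have := bounded _ _ (lexx _) cm; have := le_normc_Re _ c.
have : 2 * B / (m / 2) < k%:R := truncnS_gt _.
rewrite ltr_pdivrMr ?divr_gt0//; lra.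
Qed.

(** The distance [h] to [y] satisfies [|z - w| <= h z + h w], so the intervals
    [Re z - h z, Re z + h z] meet pairwise and have a common point, and likewise
    for imaginary parts. The resulting scalar [l] has [h l <= 3 * h z] for
    every [z], and the infimum of [h] is 0. *)
Lemma exists_scalar_dist0 (y : A) : exists c : R[i], q (y - c%:A) = 0.
Proof.
pose h (c : R[i]) := q (y - c%:A).
have dist z w : normc (z - w) <= h z + h w.
  rewrite -(uu_scalar uq) scalerBl.
  have -> : z%:A - w%:A = (y - w%:A) - (y - z%:A).
    by rewrite opprB [RHS]addrC addrA addrNK.
  by rewrite addrC; apply: le_trans (uuD _ uq _ _) _; rewrite (uuN uq).
have [|a ha] := exists_between (0 : R[i])
    (fun z => complex.Re z - h z) (fun z => complex.Re z + h z).
  move=> z w; have := le_trans (le_normc_Re _ _) (dist z w).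
  by case: z => ? ?; case: w => ? ? /=; lra.
have [|b hb] := exists_between (0 : R[i])
    (fun z => complex.Im z - h z) (fun z => complex.Im z + h z).
  move=> z w; have := le_trans (le_normc_Im _ _) (dist z w).
  by case: z => ? ?; case: w => ? ? /=; lra.
pose l := Complex a b.
have hl z : h l <= 3 * h z.
  have : normc (z - l) <= 2 * h z.
    apply: le_trans (normc_Re_Im _ _) _; have := ha z; have := hb z.
    case: z => u v /= [b1 b2] [a1 a2].
    have : `|u - a| <= h (Complex u v) by rewrite ler_norml; lra.
    have : `|v - b| <= h (Complex u v) by rewrite ler_norml; lra.
    lra.
  have : h l <= h z + normc (z - l).
    rewrite -(uu_scalar uq) scalerBl; apply: le_trans (uuD _ uq _ _).
    by rewrite addrA addrNK.
  lra.
exists l; apply/eqP; rewrite eq_le uu_ge0// andbT leNgt; apply/negP => l0.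
have l3 : 0 < q (y - l%:A) / 3 by rewrite divr_gt0.
have [c] := dist_scalars_inf0 y _ l3.
have := hl c; rewrite /h; lra.
Qed.

Lemma character_of_multiplicative : exists g : A -> R[i],
  [/\ scalar g, {morph g : x y / x * y} & forall x, normc (g x) = q x].
Proof.
have [g hg] := choice exists_scalar_dist0.
have g_uniq x c : q (x - c%:A) <= 0 -> g x = c.
  move=> xc; apply/eqP; rewrite -subr_eq0; apply/eqP/Normc.eq0_normc.
  apply/eqP; rewrite eq_le normc_ge0 andbT -(uu_scalar uq) scalerBl.
  have -> : (g x)%:A - c%:A = (x - c%:A) - (x - (g x)%:A).
    by rewrite opprB [RHS]addrC addrA addrNK.
  by apply: le_trans (uuD _ uq _ _) _; rewrite (uuN uq) hg addr0.
exists g; split.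
- move=> a x y; apply: g_uniq.
  have -> : a *: x + y - (a * g x + g y)%:A
            = a *: (x - (g x)%:A) + (y - (g y)%:A).
    by rewrite scalerDl scalerBr scalerA opprD addrACA.
  by apply: le_trans (uuD _ uq _ _) _; rewrite (uuZ _ uq) !hg mulr0 addr0.
- move=> x y; apply: g_uniq.
  have -> : x * y - (g x * g y)%:A
            = (x - (g x)%:A) * y + (g x)%:A * (y - (g y)%:A).
    by rewrite mulrBl mulrBr addrA addrNK -[(g x)%:A * _%:A]scalerAl mul1r scalerA.
  by apply: le_trans (uuD _ uq _ _) _; rewrite !qM !hg mul0r mulr0 addr0.
- move=> x; rewrite -(uu_scalar uq); apply/le_anti/andP; split.
    rewrite -[(g x)%:A](subKr x); apply: le_trans (uuD _ uq _ _) _.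
    by rewrite (uuN uq) hg addr0.
  rewrite -[x in q x <= _](subrK (g x)%:A); apply: le_trans (uuD _ uq _ _) _.
  by rewrite hg add0r.
Qed.
End MultiplicativeSeminorm.

(** * Norming characters *)

Lemma exists_norming_character (R : realType) (A : algType R[i]) (p : A -> R) (x : A) :
  (forall u v : A, u * v = v * u) -> unital_uniform p -> 0 < p x ->
  exists g : A -> R[i], [/\ scalar g, {morph g : u v / u * v},
    (forall u, normc (g u) <= p u) & normc (g x) = p x].
Proof.
move=> comm up px.
have [q [uq qM qp qx]] := exists_multiplicative_minorant _ _ _ _ comm up px.
have [g [glin gM gq]] := character_of_multiplicative uq qM.
exists g; split=> // [u|]; rewrite gq//.
by apply/le_anti; rewrite qx qp.
Qed.

(** * Uniform norms as real unital uniform seminorms *)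

Section UniformNorms.
Context {R : realType} {A : algType R[i]}.

Definition real_part (p : A -> R[i]) (x : A) : R := complex.Re (p x).

Lemma seminormE (p : A -> R[i]) : seminorm p ->
  forall x, p x = real_complex R (real_part p x).
Proof. by move=> sp x; rewrite /real_part RRe_real// ger0_real// seminorm_ge0. Qed.

(** Converts between the order of [R[i]] and that of [R]. *)
Lemma normr_le_seminorm (p : A -> R[i]) : seminorm p ->
  forall z x, (`|z| <= p x) = (normc z <= real_part p x).
Proof. by move=> sp z x; rewrite (seminormE p sp) -lecR. Qed.

Lemma uniform_norm_unital_uniform (p : A -> R[i]) : uniform_norm p ->
  (forall x y, real_part p (x * y) <= real_part p x * real_part p y) ->
  unital_uniform (real_part p).
Proof.
move=> [[sp psq] p_eq0] pM; have pE := seminormE p sp; split => //.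
- by move=> x y; rewrite -lecR rmorphD /= -!pE (seminormD sp).
- by move=> a x; apply: complexI; rewrite rmorphM /= -!pE (seminormZ sp).
- by move=> x; apply: complexI; rewrite rmorphXn /= -!pE psq.
- apply: complexI; rewrite -pE rmorph1.
  have /eqP := psq 1; rewrite expr1n expr2 -subr_eq0 -{1}[p 1]mulr1 -mulrBr mulf_eq0.
  rewrite subr_eq0 => /orP[/eqP/p_eq0/eqP|/eqP/esym//].
  by rewrite oner_eq0.
Qed.

(** Polarization, [4 x y = (x + y) ^ 2 - (x - y) ^ 2], gives
    [p (x y) <= 2 p x p y] after rescaling [x] and [y] to equal norms; then take
    [2 ^ n]-th roots. *)
Lemma uniform_norm_submultiplicative (p : A -> R[i]) :
  (forall x y : A, x * y = y * x) -> uniform_norm p ->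
  forall x y, real_part p (x * y) <= real_part p x * real_part p y.
Proof.
move=> comm [[sp psq] p_eq0]; have pE := seminormE p sp.
set q := real_part p.
have q0 x : 0 <= q x by rewrite -ler0c -pE seminorm_ge0.
have qD x y : q (x + y) <= q x + q y by rewrite -lecR rmorphD /= -!pE (seminormD sp).
have qZ a x : q (a *: x) = normc a * q x.
  by apply: complexI; rewrite rmorphM /= -!pE (seminormZ sp).
have q00 : q 0 = 0 by rewrite -(scale0r (0 : A)) qZ Normc.normc0 mul0r.
have qsq x : q (x ^+ 2) = q x ^+ 2.
  by apply: complexI; rewrite rmorphXn /= -!pE psq.
have q_eq0 x : q x = 0 -> x = 0 by move=> qx; apply: p_eq0; rewrite pE -/q qx.
have quad x y : 2 * q (x * y) <= (q x + q y) ^+ 2.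
  have polar : (4 : R[i]) *: (x * y) = (x + y) ^+ 2 + (-1) *: (x + (-1) *: y) ^+ 2.
    have sqD z : x * z = z * x -> (x + z) ^+ 2 = (x ^+ 2 + z ^+ 2) + x * z *+ 2.
      by move=> xz; rewrite !expr2 mulrDl !mulrDr -xz mulr2n (addrC (x * z) (z * z)) addrACA.
    rewrite !scaleN1r !sqD // sqrrN mulrN mulNrn opprD opprK addrACA subrr add0r.
    by rewrite -mulrnDr scaler_nat.
  have : q ((4 : R[i]) *: (x * y)) <= 2 * (q x + q y) ^+ 2.
    rewrite polar; apply: le_trans (qD _ _) _.
    rewrite qZ normcN Normc.normc1 mul1r !qsq mulr_natl mulr2n.
    have qN : q (x + (-1) *: y) <= q x + q y.
      by apply: le_trans (qD _ _) _; rewrite qZ normcN Normc.normc1 mul1r.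
    by rewrite lerD// lerXn2r ?nnegrE ?addr_ge0.
  rewrite qZ normc_nat; lra.
have weak x y : q (x * y) <= 2 * (q x * q y).
  have [qx|qx] := eqVneq (q x) 0; first by rewrite qx (q_eq0 _ qx) mul0r q00 mul0r mulr0.
  have [qy|qy] := eqVneq (q y) 0; first by rewrite qy (q_eq0 _ qy) mulr0 q00 !mulr0.
  have qx0 : 0 < q x by rewrite lt0r qx q0.
  have qy0 : 0 < q y by rewrite lt0r qy q0.
  have := quad (real_complex R (q y) *: x) (real_complex R (q x) *: y).
  rewrite -scalerAl -scalerAr !qZ !normc_real ?q0//.
  have -> : 2 * (q y * (q x * q (x * y))) = (q x * q y) * (2 * q (x * y)) by ring.
  have -> : (q y * q x + q x * q y) ^+ 2 = (q x * q y) * (2 * (2 * (q x * q y))) by ring.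
  by rewrite ler_pM2l ?mulr_gt0// ler_pM2l.
move=> x y; apply: (le_of_exp_le _ _ _ 2); rewrite ?mulr_ge0// => n.
rewrite -(exp2n_morph _ _ q qsq) exprMn_comm; last exact: comm.
by rewrite (le_trans (weak _ _))// !(exp2n_morph _ _ q qsq) exprMn.
Qed.
End UniformNorms.

(** * Characters and the topology *)

Section BoundedCharacters.
Context {K : numFieldType} {A : algType K} (N : vnorm A).

Lemma scalarB (g : A -> K) : scalar g -> forall x y, g (x - y) = g x - g y.
Proof.
move=> glin x y; have := glin (-1) y x.
by rewrite scaleN1r (addrC (- y)) mulN1r (addrC (- g y)).
Qed.

Lemma scalarZ (g : A -> K) : scalar g -> forall a x, g (a *: x) = a * g x.
Proof.
move=> glin a x; have g0 : g 0 = 0 by rewrite -(subrr 0) (scalarB g glin) subrr.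
by have := glin a x 0; rewrite !addr0 g0 addr0.
Qed.

Lemma bounded_character_mem (g : A -> K) : scalar g -> {morph g : x y / x * y} ->
  (forall x, `|g x| <= N x) -> (exists x, g x <> 0) ->
  characters N g.
Proof.
move=> glin gM gN gneq0.
suff gcont : continuous (g : normed_by N -> K) by split.
move=> x U /nbhs_ballP[e /= e0 eU].
have gB := scalarB g glin.
apply/nbhs_ballP; exists e => //= y.
move=> xy; have {}xy : N ((x : A) - y) < e := xy.
by apply: eU; rewrite -ball_normE /= -gB; exact: le_lt_trans (gN _) xy.
Qed.

Lemma gelfand_transform_continuous (x : A) : continuous (gelfand_transform (N := N) x).
Proof.
move=> g; apply: (@continuous_comp _ _ _ (set_val : characters N -> {ptws A -> K}) (fun h => h x)).
  exact: initial_continuous.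
exact: proj_continuous.
Qed.

Lemma closed_le_norm (c : K) : c \is Num.real ->
  closed [set z : K | `|z| <= c]%classic.
Proof.
move=> cr; rewrite -openC openE => z /= /negP.
rewrite -real_ltNge ?normr_real// => cz.
apply/nbhs_ballP; exists (`|z| - c) => [|w /=]; first by rewrite /= subr_gt0.
rewrite -ball_normE /= => zw; apply/negP; rewrite -real_ltNge ?normr_real//.
by have := le_lt_trans (lerB_dist z w) zw; rewrite ltrD2l ltrN2.
Qed.

Lemma closed_bounded_characters (p : A -> K) : (forall x, 0 <= p x) ->
  closed [set g : characters N | forall x, `|gelfand_transform x g| <= p x]%classic.
Proof.
move=> p0.
have -> : [set g : characters N | forall x, `|gelfand_transform x g| <= p x]%classic =
   (\bigcap_(x in [set: A]) (gelfand_transform (N := N) x @^-1` [set z | `|z| <= p x]))%classic.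
  by apply/seteqP; split => g /= gp x => [_|]; exact: gp.
apply: closed_bigI => x _; apply: preimage_closed.
  by move=> g _; exact: gelfand_transform_continuous.
by apply: closed_le_norm; rewrite ger0_real.
Qed.

End BoundedCharacters.

Section Characters.
Context {R : realType} {A : algType R[i]} (N : vnorm A).

Lemma Q_algebra_ball : Q_algebra N ->
  exists2 e : R, 0 < e & forall x, N x < real_complex R e -> quasi_invertible x.
Proof.
move=> Qop.
have qi0 : quasi_invertible (0 : A).
  by exists 0; rewrite addr0 mulr0 subrr.
have /nbhs_ballP[e /= e0 eQ] := open_nbhs_nbhs (conj Qop qi0).
exists (complex.Re e) => [|x Nx].
  by move: e0; rewrite ltcE => /andP[].
apply: (eQ x); rewrite -ball_normE /= sub0r normrN.
by move: Nx; rewrite RRe_real// gtr0_real.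
Qed.

(** If [x] is small then [x] is quasi-invertible, so that [g x <> 1]. By
    homogeneity [g] is bounded by a multiple of the norm, and the multiple is
    removed by taking [2 ^ n]-th roots. *)
Lemma Q_algebra_character_le (uN : unital_uniform (real_part N)) (g : A -> R[i]) :
  Q_algebra N -> scalar g -> {morph g : x y / x * y} ->
  forall x, normc (g x) <= real_part N x.
Proof.
move=> QN glin gM x.
have NE := seminormE _ (vnorm_seminorm N).
have [gB gZ] := (scalarB g glin, scalarZ g glin).
have [e e0 eQ] := Q_algebra_ball QN.
have bound z : normc (g z) <= e^-1 * real_part N z.
  rewrite leNgt mulrC ltr_pdivrMr//; apply/negP => gz.
  have gz0 : g z != 0.
    apply: contraTneq gz => ->; rewrite Normc.normc0 mul0r -leNgt.
    exact: uu_ge0.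
  have [|y [yE _]] := eQ ((g z)^-1 *: z).
    rewrite (seminormZ (vnorm_seminorm N)) NE normfV -[`|g z|]/(real_complex R (normc (g z))).
    rewrite mulrC ltr_pdivrMr; last first.
      by rewrite -[_ (normc _)]/(`|g z|) normr_gt0.
    by rewrite -rmorphM ltcR mulrC.
  have : g ((g z)^-1 *: z + y - (g z)^-1 *: z * y) = 1.
    have gw : g ((g z)^-1 *: z) = 1 by rewrite gZ mulVf.
    have := glin 1 ((g z)^-1 *: z) y; rewrite scale1r mul1r => gwy.
    by rewrite gB gwy gM gw mul1r addrK.
  rewrite yE -[0](scale0r z) gZ mul0r => /esym/eqP.
  by rewrite oner_eq0.
have gsq z : normc (g (z ^+ 2)) = normc (g z) ^+ 2.
  by rewrite !expr2 gM Normc.normcM.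
apply: (le_of_exp_le _ _ _ e^-1); rewrite ?normc_ge0 ?uu_ge0// => n.
rewrite -(exp2n_morph _ _ (fun z => normc (g z)) gsq).
by rewrite (le_trans (bound _))// (uuX uN).
Qed.

End Characters.

(** * Uniqueness of the uniform norm *)

Theorem theorem2p3 (R : realType) (A : algType R[i]) (N : vnorm A) :
  uniform_normed_algebra N -> Q_algebra N -> regular_algebra N ->
  forall p : A -> R[i], uniform_norm p -> forall x : A, N x = p x.
Proof.
move=> [NM Nsq] QN regN p up x.
have sN := vnorm_seminorm N; have NE := seminormE _ sN.
have uN : unital_uniform (real_part N).
  apply: uniform_norm_unital_uniform; first by split; [|exact: vnorm_eq0].
  by move=> u v; rewrite -lecR rmorphM /= -!NE.
have N_eq0 u : real_part N u = 0 -> u = 0.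
  by move=> Nu; apply: (@vnorm_eq0 _ _ N); rewrite NE Nu.
have comm := unital_uniform_norm_comm uN N_eq0.
have sp := up.1.1; have pE := seminormE _ sp.
have uP := uniform_norm_unital_uniform _ up (uniform_norm_submultiplicative _ comm up).
have p_gt0 u : u <> 0 -> 0 < real_part p u.
  move=> u0; rewrite lt0r (uu_ge0 uP) andbT; apply/eqP => pu.
  by apply/u0/up.2; rewrite pE pu.
have [->|/eqP x0] := eqVneq x 0; first by rewrite NE pE !uu0.
rewrite NE pE; congr (real_complex R _); apply/le_anti/andP; split; last first.
  have [g [glin gM gp <-]] := exists_norming_character _ _ _ x comm uP (p_gt0 _ x0).
  exact: Q_algebra_character_le.
have Nx : 0 < real_part N x.
  by rewrite lt0r (uu_ge0 uN) andbT; apply/eqP => /N_eq0.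
have [f [flin fM fN fx]] := exists_norming_character _ _ _ x comm uN Nx.
have fchar : characters N f.
  apply: bounded_character_mem => // [u|]; first by rewrite normr_le_seminorm.
  by exists x => fx0; move: Nx; rewrite -fx fx0 Normc.normc0 ltxx.
pose F := [set g : characters N | forall u, `|gelfand_transform u g| <= p u]%classic.
pose f1 : characters N := exist _ f (mem_set fchar).
have clF : closed F by apply: closed_bounded_characters; exact: (seminorm_ge0 sp).
have Ff1 : F f1.
  apply: contrapT => nF; have [y [Fy fy]] := regN F f1 clF nF.
  have y0 : y <> 0.
    move=> y0; apply: fy; rewrite /gelfand_transform /= y0; apply: Normc.eq0_normc.
    by apply/le_anti; rewrite normc_ge0 (le_trans (fN _))// (uu0 uN).
  have [g [glin gM gp gy]] := exists_norming_character _ _ _ y comm uP (p_gt0 _ y0).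
  have gy0 : g y <> 0 by move=> gy0; have := p_gt0 _ y0; rewrite -gy gy0 Normc.normc0 ltxx.
  have gchar : characters N g.
    apply: bounded_character_mem => // [u|]; last by exists y.
    by rewrite normr_le_seminorm//; exact: Q_algebra_character_le.
  apply: gy0; apply: (Fy (exist _ g (mem_set gchar))) => u.
  rewrite normr_le_seminorm //; exact: gp.
by rewrite -fx -normr_le_seminorm//; exact: (Ff1 x).
Qed.
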